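(* $$\sup_{x,y\in\mathbb{Z}\setminus\{0\}}\left|\{(n,i,j)\in\mathbb{N}^3:\ y\cdot 2^{2^n}-x=3^i5^j\}\right|\leq 17.$$
   Context: $\mathbb{N}$ denotes the set of non-negative integers. *)

(* Defs.v *)
From mathcomp Require Import all_boot all_order all_algebra.
From mathcomp Require Import classical_sets functions cardinality.

Set Implicit Arguments.
Unset Strict Implicit.
Unset Printing Implicit Defensive.

(* Main.v *)
(** After division by gcd(x, y), the numbers s_n = y A_n - x with A_n = 2^(2^n)
that have the form 3^i 5^j are coprime to y, so gcd(s_m, s_n) divides
A_n - A_m; lifting the exponent gives gcd(s_m, s_n) <= 225 (n - m)^2. Sort the
solutions into three classes, according to whether 5^j <= 3^(i/2),
3^i <= 5^(j/2) or neither. Two numbers s, t of one class satisfy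
gcd(s^K, t)^3 >= min(s^K, t)^2. With K = 1 this forces, for m < n in one class,
n - m to be exponentially large in 2^m. Hence, if l < m < n are in one class
and y > 0, then x and y are tiny compared with A_m. Put K = 2^(n - m), so that
A_n = A_m^K. Diagonal Padé approximants to (1 - z)^K at z = x / (y A_m) yield a
nonzero integer divisible by gcd(s_m^K, s_n) of size about A_m^(K/2), which
contradicts gcd(s_m^K, s_n) >= A_m^(2K/3) up to small factors. If y < 0,
the gap estimate with K = 1 suffices, because every s_n except the last is
comparable with A_M, where M is the largest index. So each class contains at
most 5 solutions with n >= 2, which gives 2 + 3 * 5 = 17. *)
Require Import Defs.
From mathcomp Require Import all_boot all_order all_algebra.
From mathcomp Require Import boolp classical_sets functions cardinality.
From mathcomp Require Import ring lra zify.

Set Implicit Arguments.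
Unset Strict Implicit.
Unset Printing Implicit Defensive.

Import Order.TTheory GRing.Theory Num.Theory.

Local Open Scope classical_set_scope.
Local Open Scope ring_scope.
Local Open Scope card_scope.

(** * Padé approximants to powers of [1 - X] *)

Lemma coef_exp_1subX (n i : nat) :
  ((1 - 'X : {poly int}) ^+ n)`_i = (-1) ^+ i * 'C(n, i)%:R.
Proof.
rewrite exprBn coef_sum.
under eq_bigr => k _ do rewrite expr1n mulr1 coefMn -signr_odd.
case: (ltnP i n.+1) => hi; last first.
  rewrite bin_small // mulr0 big1 // => k _.
  rewrite -(rmorph_sign polyC) coefCM coefXn.
  have /negbTE -> : i != k by have := ltn_ord k; lia.
  by rewrite mulr0 mul0rn.
rewrite (bigD1 (Ordinal hi)) //= big1 ?addr0 => [|k hk].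
  by rewrite -(rmorph_sign polyC) coefCM coefXn eqxx mulr1 signr_odd mulr_natr.
rewrite -(rmorph_sign polyC) coefCM coefXn.
have /negbTE -> : i != k by apply: contraNneq hk => hk; apply/eqP/val_inj.
by rewrite mulr0 mul0rn.
Qed.

Lemma bin_ffactD (m n j : nat) :
  ('C(m + n, m + j) * (m + j) ^_ m = (m + n) ^_ m * 'C(n, j))%N.
Proof.
apply/eqP; rewrite -(eqn_pmul2r (fact_gt0 j)) -!mulnA bin_ffact.
have -> : ((m + j) ^_ m * j`! = (m + j)`!)%N.
  by rewrite -(ffact_fact (leq_addr j m)) addKn.
rewrite bin_ffact; apply/eqP.
elim: m => [|m IHm]; first by rewrite !add0n ffactn0 mul1n.
by rewrite !addSn !ffactSS -mulnA IHm.
Qed.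

(** Both sides are the coefficient of [X^h] in [(1 + X)^a * (1 + X)^(- b.+1)]; the induction rests
    on Pascal's rule. *)
Lemma bin_Vandermonde_neg (a b h : nat) : (b < a)%N ->
  \sum_(k < h.+1) (-1) ^+ k * ('C(a, h - k) * 'C(b + k, k))%:R
    = 'C(a - b.+1, h)%:R :> int.
Proof.
move=> hab.
have base c g : \sum_(k < g.+1) (-1) ^+ k * 'C(c.+1, g - k)%:R
    = 'C(c, g)%:R :> int.
  elim: g => [|g IHg]; first by rewrite big_ord1 !bin0 mul1r.
  rewrite big_ord_recl /= mul1r subn0 binS natrD -[RHS]addr0 -addrA; congr (_ + _).
  rewrite -IHg -big_split /= big1 // => k _.
  by rewrite /bump /= add1n subSS exprS; ring.
elim: b h hab => [|b IHb] h hab.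
  rewrite -[RHS]base; have -> : (a - 1).+1 = a by lia.
  by apply: eq_bigr => k _; rewrite add0n binn muln1.
elim: h => [|h IHh]; first by rewrite big_ord1 !bin0 mul1r.
have := IHb h.+1 (ltnW hab).
have -> : (a - b.+1 = (a - b.+2).+1)%N by lia.
rewrite binS natrD => E.
apply: (addIr ('C(a - b.+2, h)%:R)); rewrite -E -IHh.
rewrite [in LHS]big_ord_recl [RHS]big_ord_recl.
rewrite /= !subn0 !bin0 !muln1 -addrA; congr (_ + _).
rewrite -big_split /=; apply: eq_bigr => k _.
rewrite /bump /= add1n subSS exprS !addSn !addnS binS.
by rewrite mulnDr natrD; ring.
Qed.

(** The approximated power is [(1 - X) ^+ K] with [K = h.+1 + e]. The
coefficients are chosen so that the [h.+1]-st derivative of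
[(1 - X) ^+ K * pade e h] is a constant times [(1 - X) ^+ e * 'X^h]; this is
why its coefficients in degrees [h.+1] to [h.*2] vanish. *)
Definition pade_coef (e h k : nat) : int :=
  (-1) ^+ k * ('C(h.*2.+1 + e, h - k) * 'C(e + k, k))%:R.

Definition pade (e h : nat) : {poly int} :=
  \sum_(k < h.+1) (pade_coef e h k) *: (1 - 'X) ^+ k.

Definition padeF (e h : nat) : {poly int} := (1 - 'X) ^+ (h.+1 + e) * pade e h.

Lemma padeFE e h :
  padeF e h = \sum_(k < h.+1) (pade_coef e h k) *: (1 - 'X) ^+ (h.+1 + e + k).
Proof.
rewrite /padeF mulr_sumr; apply: eq_bigr => k _.
by rewrite -scalerAr -exprD.
Qed.

Lemma coef_padeF e h i : (padeF e h)`_i =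
  \sum_(k < h.+1) pade_coef e h k * ((-1) ^+ i * 'C(h.+1 + e + k, i)%:R).
Proof.
rewrite padeFE coef_sum; apply: eq_bigr => k _.
by rewrite coefZ coef_exp_1subX.
Qed.

(** Up to sign and constants, this turns the [k]-th term of a coefficient of [padeF] into the [k]-th
    term of [(1 - X)^e * (1 - (1 - X))^h]. *)
Lemma pade_bin e h k j : (k <= h)%N ->
  ('C(h.*2.+1 + e, h - k) * 'C(e + k, k) * 'C(h.+1 + e + k, h.+1 + j)
   * ((h.+1 + j) ^_ h.+1 * (h`! * e`!))
   = (h.*2.+1 + e)`! * ('C(h, k) * 'C(e + k, j)))%N.
Proof.
move=> hk.
have E1 : ('C(h.*2.+1 + e, h - k) * ((h - k)`! * (h.+1 + e + k)`!)
            = (h.*2.+1 + e)`!)%N.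
  have -> : (h.+1 + e + k = h.*2.+1 + e - (h - k))%N by lia.
  by rewrite bin_fact //; lia.
have E2 : ('C(e + k, k) * (k`! * e`!) = (e + k)`!)%N.
  by rewrite -{2}(addnK k e) bin_fact // leq_addl.
have E3 : ((h.+1 + e + k) ^_ h.+1 * (e + k)`! = (h.+1 + e + k)`!)%N.
  have -> : (e + k = h.+1 + e + k - h.+1)%N by lia.
  by rewrite ffact_fact //; lia.
have E4 := bin_fact hk.
have E5 := bin_ffactD h.+1 (e + k) j; rewrite addnA in E5.
rewrite -E1 -E3 -E2 -E4.
transitivity (('C(h.+1 + e + k, h.+1 + j) * (h.+1 + j) ^_ h.+1) *
  ('C(h.*2.+1 + e, h - k) * 'C(e + k, k) * 'C(h, k) * (k`! * (h - k)`!) * e`!))%N.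
  by ring.
by rewrite E5; ring.
Qed.

(** The derivative identity, read coefficientwise: [(h.+1 + j) ^_ h.+1] is the factor that [h.+1]
    derivatives put on the term of degree [h.+1 + j]. *)
Lemma coef_padeF_fact e h j :
  (padeF e h)`_(h.+1 + j) * ((h.+1 + j) ^_ h.+1 * (h`! * e`!))%:R
   = (-1) ^+ (h.+1 + j) * (-1) ^+ j * ((h.*2.+1 + e)`!)%:R
     * ((1 - 'X) ^+ e * 'X^h : {poly int})`_j.
Proof.
have -> : 'X^h = (1 - (1 - 'X)) ^+ h :> {poly int} by congr (_ ^+ h); ring.
rewrite (exprBn 1 (1 - 'X)) mulr_sumr coef_sum mulr_sumr coef_padeF mulr_suml.
apply: eq_bigr => k _; rewrite expr1n mulr1.
have -> : ((1 - 'X) ^+ e * ((-1) ^+ k * (1 - 'X) ^+ k *+ 'C(h, k)) : {poly int})`_j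
    = (-1) ^+ k * (-1) ^+ j * ('C(h, k)%:R * 'C(e + k, j)%:R).
  rewrite -mulrnAl mulrCA -(exprD (1 - 'X)) -mulr_natl -(signr_odd _ k).
  rewrite -(rmorph_sign polyC) -polyC_natr -polyCM coefCM signr_odd.
  by rewrite coef_exp_1subX; ring.
have hk : (k <= h)%N by have := ltn_ord k; lia.
have := sqrr_sign int j; rewrite expr2 => S2.
rewrite /pade_coef; move: (pade_bin e j hk).
move: 'C(_, h - k) 'C(e + k, k) 'C(_, h.+1 + j) (_ * (h`! * e`!))%N (_ + e)`!.
move=> a b c d f /(congr1 (fun n => n%:R : int)); rewrite !natrM => E.
transitivity ((-1) ^+ k * (-1) ^+ (h.+1 + j) * (a%:R * b%:R * c%:R * d%:R) : int).
  by ring.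
by rewrite E -[LHS]mulr1 -[X in _ * X = _]S2; ring.
Qed.

Lemma coef_padeF_eq0 e h i : (h < i <= h.*2)%N -> (padeF e h)`_i = 0.
Proof.
move=> /andP[h1 h2]; have Hi : i = (h.+1 + (i - h.+1))%N by lia.
have := coef_padeF_fact e h (i - h.+1); rewrite -Hi coefMXn.
rewrite ifT ?mulr0; last by lia.
move/eqP; rewrite mulf_eq0 => /orP[/eqP //|].
have f0 : (0 < i ^_ h.+1)%N by rewrite ffact_gt0.
by rewrite pnatr_eq0 eqn0Ngt muln_gt0 f0 muln_gt0 !fact_gt0.
Qed.

Lemma coef_padeF_neq0 e h : (padeF e h)`_(h.*2.+1) != 0.
Proof.
have := coef_padeF_fact e h h; rewrite addSn addnn coefMXn ltnn subnn.
rewrite coef_exp_1subX bin0 expr0 !mulr1 => E.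
have : (padeF e h)`_(h.*2.+1) * (h.*2.+1 ^_ h.+1 * (h`! * e`!))%:R != 0.
  by rewrite E !mulf_neq0 ?signr_eq0 ?pnatr_eq0 -?lt0n ?fact_gt0.
by apply: contraNneq => ->; rewrite mul0r.
Qed.

Lemma pade_horner0 e h : (pade e h).[0] = 'C(h.*2, h)%:R.
Proof.
(* The value at 0 is the sum of all [pade_coef e h k], an alternating Vandermonde sum. *)
have -> : h.*2 = (h.*2.+1 + e - e.+1)%N by lia.
rewrite -bin_Vandermonde_neg ?horner_sum; last by lia.
by apply: eq_bigr => k _; rewrite hornerZ horner_coef0 coef_exp_1subX bin0 expr0 !mulr1.
Qed.

Lemma size_exp_1subX n : (size ((1 - 'X : {poly int}) ^+ n) <= n.+1)%N.
Proof.
apply/leq_sizeP => i hi.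
by rewrite coef_exp_1subX bin_small ?mulr0.
Qed.

Lemma size_pade e h : (size (pade e h) <= h.+1)%N.
Proof.
rewrite (leq_trans (size_sum _ _ _)) //; apply/bigmax_leqP => k _.
by rewrite (leq_trans (size_scale_leq _ _)) // (leq_trans (size_exp_1subX _)).
Qed.

Lemma size_padeF e h : (size (padeF e h) <= h.*2.+1 + e.+1)%N.
Proof.
rewrite padeFE (leq_trans (size_sum _ _ _)) //; apply/bigmax_leqP => k _.
rewrite (leq_trans (size_scale_leq _ _)) // (leq_trans (size_exp_1subX _)) //.
by have := ltn_ord k; lia.
Qed.

Lemma bin_le_expn2 n k : ('C(n, k) <= 2 ^ n)%N.
Proof.
elim: n k => [|n IHn] [|k] //; first by rewrite bin0 expn_gt0.
by rewrite binS expnS mul2n -addnn leq_add.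
Qed.

Lemma padeF_coef_le e h i : `|(padeF e h)`_i| <= (2 ^ (6 * h + 3 * e + 2))%:R.
Proof.
rewrite coef_padeF (le_trans (ler_norm_sum _ _ _)) //.
apply: (@le_trans _ _ (\sum_(k < h.+1) (2 ^ (5 * h + 3 * e + 2))%:R)).
  apply: ler_sum => k _.
  rewrite !normrM !normrX !normrN1 !expr1n !mul1r !normr_nat -!natrM ler_nat.
  (* The exponent adds up the upper indices of the three binomials, with [k] bounded by [h]; the
     [h.+1] summands cost another [2 ^ h]. *)
  have -> : (5 * h + 3 * e + 2
     = (h.*2.+1 + e) + (e + h) + (h.+1 + e + h))%N by lia.
  have hk : (k <= h)%N by rewrite -ltnS.
  have le2 n l N : (n <= N)%N -> ('C(n, l) <= 2 ^ N)%N.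
    by move=> hN; rewrite (leq_trans (bin_le_expn2 _ _)) // leq_exp2l.
  by rewrite 2!expnD; do !apply: leq_mul; apply: le2; rewrite ?leq_add2l.
rewrite sumr_const card_ord -mulrnA ler_nat.
have -> : (6 * h + 3 * e + 2 = 5 * h + 3 * e + 2 + h)%N by lia.
by rewrite [leqRHS]expnD leq_mul // ltn_expl.
Qed.

(** [padeQ] is the numerator of the approximant to [(1 - X)^(h.+1 + e)] with denominator [pade], and
    [padeR] gives the remainder, of order [h.*2.+1] at 0. *)
Definition padeQ e h : {poly int} := take_poly h.+1 (padeF e h).
Definition padeR e h : {poly int} := drop_poly h.*2.+1 (padeF e h).

Lemma padeQR e h : padeF e h = padeQ e h + padeR e h * 'X^(h.*2.+1).
Proof.
rewrite -[LHS](poly_take_drop h.*2.+1); congr (_ + _).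
apply/polyP => i; rewrite !coef_take_poly.
case: ifP => h1; case: ifP => h2 //; last by lia.
by rewrite coef_padeF_eq0 //; lia.
Qed.

Lemma size_padeR e h : (size (padeR e h) <= e.+1)%N.
Proof. by rewrite size_drop_poly leq_subLR size_padeF. Qed.

(** Two consecutive approximants are never proportional at a nonzero point, so
one of the two auxiliary integers built from them is nonzero. *)
Lemma pade_det e h : exists2 k : int, k != 0 &
  pade e.+1 h * padeQ e h.+1 - pade e h.+1 * padeQ e.+1 h = k%:P * 'X^(h.*2.+1).
Proof.
set P1 := pade e.+1 h; set P2 := pade e h.+1.
set D := _ - _.
(* The parameters [(e.+1, h)] and [(e, h.+1)] belong to the same power of [1 - X]. Eliminating it
   leaves a multiple of ['X^(h.*2.+1)] of degree at most [h.*2.+1], hence a monomial. *)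
pose S := P2 * padeR e.+1 h - P1 * padeR e h.+1 * 'X^2.
have DE : D = S * 'X^(h.*2.+1).
  have E : P1 * padeF e h.+1 = P2 * padeF e.+1 h.
    by rewrite /padeF -/P1 -/P2 (addSnnS h.+1 e); ring.
  move/eqP: E; rewrite -subr_eq0 !padeQR doubleS => /eqP E.
  by rewrite -[RHS]addr0 -E /D /S !exprS; ring.
have hS : (size S <= 1)%N.
  have [->|nS] := eqVneq S 0; first by rewrite size_poly0.
  have : (size D <= h.*2.+2)%N.
    rewrite (leq_trans (size_polyD _ _)) // size_polyN geq_max.
    have q1 := size_pade e.+1 h; have q2 := size_pade e h.+1.
    have q3 : (size (padeQ e h.+1) <= h.+2)%N by apply: size_take_poly.
    have q4 : (size (padeQ e.+1 h) <= h.+1)%N by apply: size_take_poly.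
    move: q1 q2 q3 q4; rewrite -/P1 -/P2 => q1 q2 q3 q4.
    apply/andP; split; rewrite (leq_trans (size_polyMleq _ _)) //.
      by move: (leq_add q1 q3); move: (_ + _)%N => n; lia.
    by move: (leq_add q2 q4); move: (_ + _)%N => n; lia.
  by rewrite DE size_mulXn // -(addn1 h.*2.+1) leq_add2l.
exists S`_0; last by rewrite DE -size1_polyC.
(* The constant term of [S] is [P2] at 0 times the coefficient of degree [h.*2.+1] in
   [padeF e.+1 h]; both are nonzero. *)
rewrite coefB coefMXn subr0 -!horner_coef0 hornerM pade_horner0.
rewrite mulf_neq0 //; last first.
  by rewrite horner_coef0 coef_drop_poly add0n coef_padeF_neq0.
by rewrite pnatr_eq0 -lt0n bin_gt0 -addnn leq_addr.
Qed.

(** * Integers obtained from the approximants at [x / c] *)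

Definition homog (N : nat) (f : {poly int}) (x c : int) : int :=
  \sum_(i < N.+1) f`_i * x ^+ i * c ^+ (N - i).

Lemma homogE N (f : {poly int}) (x c : int) : (size f <= N.+1)%N -> c != 0 ->
  (homog N f x c)%:~R
    = c%:~R ^+ N * (map_poly intr f).[x%:~R / c%:~R] :> rat.
Proof.
move=> hf c0; rewrite (@horner_coef_wide _ N.+1); last first.
  exact: leq_trans (size_poly _ _) hf.
rewrite mulr_sumr rmorph_sum; apply: eq_bigr => i _.
rewrite coef_map !rmorphM !rmorphXn /= exprMn.
have -> : c%:~R ^+ N = c%:~R ^+ (N - i) * c%:~R ^+ i :> rat.
  by rewrite -exprD subnK // -ltnS.
have : c%:~R ^+ i != 0 :> rat by rewrite expf_neq0 // intr_eq0.
by rewrite exprVn; move: (c%:~R ^+ i) => u hu; field.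
Qed.

Lemma homog_le N (f : {poly int}) (x c M : int) :
  (forall i, `|f`_i| <= M) -> `|x| <= c ->
  `|homog N f x c| <= M * c ^+ N *+ N.+1.
Proof.
move=> hM xc; rewrite (le_trans (ler_norm_sum _ _ _)) //.
rewrite -[in leRHS](card_ord N.+1) -sumr_const; apply: ler_sum => i _.
have c0 : 0 <= c by rewrite (le_trans _ xc).
have hi : (i <= N)%N by rewrite -ltnS.
rewrite !normrM !normrX (ger0_norm c0) -mulrA.
apply: ler_pM => //; first by rewrite mulr_ge0 ?exprn_ge0.
rewrite -[in leRHS](subnKC hi) exprD ler_wpM2r ?exprn_ge0 //.
by rewrite lerXn2r ?nnegrE.
Qed.

(** The auxiliary integer: common divisors of [s ^+ (h.+1 + e)] and [r] divide it. It is used with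
    [c = y * a], [s = c - x] and [r = y ^+ (h + e) * t]. *)
Definition padeV (e h : nat) (x c r s : int) : int :=
  s ^+ (h.+1 + e) * homog h (pade e h) x c - r * homog h (padeQ e h) x c.

(** Put [K = h.+1 + e] and evaluate [padeQR] at [x / c]; since [c^K - u * t = u * x], the large
    terms cancel. *)
Lemma padeVE e h (x c s u t : int) :
  c != 0 -> s = c - x -> c ^+ (h.+1 + e) = u * (t + x) ->
  padeV e h x c (u * t) s = x ^+ h.*2.+1 * homog e (padeR e h) x c
     + u * x * homog h (padeQ e h) x c.
Proof.
move=> c0 -> /(congr1 (fun n : int => n%:~R : rat)) E.
apply: (@intr_inj rat); rewrite /padeV; move: E.
rewrite !(rmorphM, rmorphD, rmorphN, rmorphXn) /=.
have sQ : (size (padeQ e h) <= h.+1)%N by apply: size_take_poly.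
rewrite !homogE ?size_pade ?size_padeR //.
have C0 : c%:~R != 0 :> rat by rewrite intr_eq0.
set C := c%:~R; set z := _ / _.
have : (map_poly intr (padeF e h)).[z] =
    (map_poly intr (padeQ e h + padeR e h * 'X^(h.*2.+1))).[z] :> rat.
  by rewrite -padeQR.
rewrite /padeF rmorphD !rmorphM /= map_polyXn rmorphXn rmorphB /= rmorph1.
rewrite map_polyX !(hornerM, hornerD, hornerN, horner_exp, hornerX, hornerC).
have -> : x%:~R = C * z by rewrite /z mulrCA divff ?mulr1.
move: (_.[z]) (_.[z]) (_.[z]) => R Q P FE E; clearbody z.
have H : C ^+ h.*2.+1 * C ^+ e = C ^+ (h.+1 + e) * C ^+ h.
  by rewrite -!exprD; congr (_ ^+ _); lia.
have -> : C - C * z = C * (1 - z) by ring.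
rewrite !exprMn.
transitivity ((C ^+ (h.+1 + e) * C ^+ h) * ((1 - z) ^+ (h.+1 + e) * P)
   - u%:~R * t%:~R * (C ^+ h * Q)); first by ring.
transitivity (C ^+ h.*2.+1 * C ^+ e * z ^+ h.*2.+1 * R
   + u%:~R * (C * z) * (C ^+ h * Q)); last by ring.
by rewrite FE H E; ring.
Qed.

(** Both integers carry the same power of [s], so if both vanish, the determinant of [pade_det]
    vanishes at [x / c], although it is a nonzero monomial. *)
Lemma padeV_neq0 e h (x c r s : int) : x != 0 -> c != 0 -> s != 0 ->
  (padeV e.+1 h x c r s != 0) || (padeV e h.+1 x c r s != 0).
Proof.
move=> x0 c0 s0; rewrite -negb_and; apply/negP => /andP[].
rewrite /padeV !subr_eq0 (addSnnS h.+1 e) => /eqP E1 /eqP E2.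
have {E1 E2} E : homog h (pade e.+1 h) x c * homog h.+1 (padeQ e h.+1) x c
         = homog h.+1 (pade e h.+1) x c * homog h (padeQ e.+1 h) x c.
  apply: (mulfI (expf_neq0 (h.+1 + e.+1) s0)).
  by rewrite mulrA E1 mulrA E2; ring.
have [k k0 /(congr1 (fun p => (map_poly intr p).[x%:~R / c%:~R] : rat))] := pade_det e h.
move/(congr1 (fun n : int => n%:~R : rat)): E.
have sQ e' h' : (size (padeQ e' h') <= h'.+1)%N by apply: size_take_poly.
rewrite !rmorphM /= !homogE ?size_pade //.
rewrite rmorphB !rmorphM /= map_polyXn map_polyC.
rewrite !(hornerM, hornerD, hornerN, horner_exp, hornerX, hornerC) /=.
have C0 : c%:~R != 0 :> rat by rewrite intr_eq0.
set C := c%:~R; set z := _ / _.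
have z0 : z != 0 by rewrite mulf_neq0 ?invr_eq0 ?intr_eq0.
move: (_.[z]) (_.[z]) (_.[z]) (_.[z]) => Q1 P2 Q2 P1 E.
have -> : P1 * Q2 = P2 * Q1.
  apply: (mulfI (mulf_neq0 (expf_neq0 h C0) (expf_neq0 h.+1 C0))).
  by move: E; rewrite -/C => E; rewrite mulrACA E; ring.
rewrite subrr => /esym /eqP; rewrite mulf_eq0 expf_eq0 (negbTE z0) andbF orbF.
by rewrite intr_eq0 (negbTE k0).
Qed.

Lemma pade_bound e h H X y Y a :
  (e <= H)%N -> (h <= H)%N -> (h.+1 + e = H.*2)%N ->
  (0 < y)%N -> (X <= Y)%N -> (y <= Y)%N -> (0 < a)%N ->
  (X ^ h.*2.+1 * (2 ^ (6 * h + 3 * e + 2) * (y * a) ^ e * e.+1) +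
     y ^ (H.*2).-1 * X * (2 ^ (6 * h + 3 * e + 2) * (y * a) ^ h * h.+1)
   <= 2 ^ (12 * H) * Y ^ (4 * H) * a ^ H)%N.
Proof.
move=> eH hH ehH y0 XY yY a0.
have Y0 : (0 < Y)%N by apply: leq_trans yY.
have mono k m n : (m <= n)%N -> (m ^ k <= n ^ k)%N.
  by case: k => // k mn; rewrite leq_exp2r.
(* Since [h + e = 2H - 1] and [h <= H], the exponent [6h + 3e + 2] is at most [9H - 1]; the factor
   [n.+1] costs at most [2^H]. Both summands get this bound. *)
have step (Z n : nat) : (Z <= Y ^ H.*2.+1)%N -> (n <= H)%N ->
  (Z * (2 ^ (6 * h + 3 * e + 2) * (y * a) ^ n * n.+1)
     <= Y ^ H.*2.+1 * (2 ^ (10 * H).-1 * (Y * a) ^ H))%N.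
  move=> hZ hn; apply: leq_mul => //; rewrite [leqLHS]mulnAC; apply: leq_mul.
    have -> : ((10 * H).-1 = (9 * H).-1 + H)%N by lia.
    rewrite [leqRHS]expnD; apply: leq_mul; first by rewrite leq_exp2l //; lia.
    by rewrite (leq_trans (ltn_expl n (ltnSn 1))) // leq_exp2l.
  apply: (@leq_trans ((Y * a) ^ n)%N); first by rewrite mono ?leq_mul.
  by rewrite leq_pexp2l // muln_gt0 Y0.
have le1 : (X ^ h.*2.+1 <= Y ^ H.*2.+1)%N.
  by rewrite (@leq_trans (Y ^ h.*2.+1)%N) ?mono // leq_pexp2l //; lia.
have le2 : (y ^ (H.*2).-1 * X <= Y ^ H.*2.+1)%N.
  have -> : (H.*2.+1 = (H.*2).-1 + 1 + 1)%N by lia.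
  rewrite !expnD !expn1 -[leqLHS]muln1; apply: leq_mul => //; apply: leq_mul => //.
  exact: mono.
apply: leq_trans (leq_add (step _ _ le1 eH) (step _ _ le2 hH)) _.
rewrite addnn -mul2n.
apply: (@leq_trans (Y ^ H.*2.+1 * (2 ^ (10 * H) * (Y * a) ^ H))%N).
  have -> : (10 * H = (10 * H).-1.+1)%N by lia.
  by rewrite /= (expnS 2) -mulnA mulnCA.
rewrite expnMn.
rewrite [leqLHS](_ : _ = 2 ^ (10 * H) * (Y ^ H.*2.+1 * Y ^ H) * a ^ H)%N; last by ring.
rewrite -expnD leq_mul // leq_mul ?leq_pexp2l //; lia.
Qed.

Lemma PoszX (m n : nat) : (m ^ n)%N%:Z = m%:Z ^+ n.
Proof. by rewrite -natz natrX natz. Qed.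

Lemma padeV_le e h H (x y : int) (a t Y : nat) :
  (e <= H)%N -> (h <= H)%N -> (h.+1 + e = H.*2)%N ->
  0 < y -> (0 < a)%N -> y * (a ^ H.*2)%N%:Z - x = t%:Z ->
  `|x| <= Y%:Z -> y <= Y%:Z -> `|x| <= y * a%:Z ->
  `|padeV e h x (y * a%:Z) (y ^+ (H.*2).-1 * t%:Z) (y * a%:Z - x)|
    <= (2 ^ (12 * H) * Y ^ (4 * H) * a ^ H)%N%:Z.
Proof.
move=> eH hH ehH y0 a0 Et xY yY xc.
rewrite padeVE //; first last.
- rewrite ehH -Et PoszX subrK exprMn mulrA -exprSr prednK //.
  by rewrite -ehH.
- by rewrite mulf_neq0 ?gt_eqF.
have QM i : `|(padeQ e h)`_i| <= (2 ^ (6 * h + 3 * e + 2))%:R.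
  by rewrite coef_take_poly; case: ifP => // _; apply: padeF_coef_le.
have RM i : `|(padeR e h)`_i| <= (2 ^ (6 * h + 3 * e + 2))%:R.
  by rewrite coef_drop_poly padeF_coef_le.
have hQ := homog_le h QM xc; have hR := homog_le e RM xc.
case: y y0 Et yY xc hQ hR => // y y0 Et yY xc hQ hR.
apply: le_trans (ler_normD _ _) _; rewrite !normrM !normrX.
apply: le_trans (lerD (ler_wpM2l _ hR) (ler_wpM2l _ hQ)) _ => //.
- exact: exprn_ge0.
- by rewrite mulr_ge0 ?exprn_ge0.
have XY : (`|x| <= Y)%N by rewrite -lez_nat abszE.
have := pade_bound eH hH ehH y0 XY yY a0.
rewrite -lez_nat; apply: le_trans; clear.
move: (2 ^ (6 * h + 3 * e + 2))%N => M.
have E (k N : nat) : M%:R * (y%:Z * a%:Z) ^+ k *+ N = (M * (y * a) ^ k * N)%N%:Z.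
  by rewrite -mulr_natr !natz -PoszM -PoszX.
by rewrite !E -abszE -!PoszX.
Qed.

(** [G] divides the auxiliary integer [padeV], for [h = H - 1] and for [h = H]. *)
Lemma pade_gap (x y : int) (a s t G Y H : nat) :
  (0 < H)%N -> x != 0 -> 0 < y -> (0 < a)%N -> (0 < s)%N ->
  y * a%:Z - x = s%:Z -> y * (a ^ H.*2)%N%:Z - x = t%:Z ->
  `|x| <= Y%:Z -> y <= Y%:Z -> `|x| <= y * a%:Z ->
  (G %| s ^ H.*2)%N -> (G %| t)%N ->
  (G <= 2 ^ (12 * H) * Y ^ (4 * H) * a ^ H)%N.
Proof.
case: H => // h _ x0 y0 a0 s0 Es Et xY yY xc Gs Gt.
have c0 : y * a%:Z != 0.
  by rewrite mulf_neq0 ?gt_eqF.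
have key e h' : (e <= h.+1)%N -> (h' <= h.+1)%N -> (h'.+1 + e = h.+1.*2)%N ->
  padeV e h' x (y * a%:Z) (y ^+ (h.+1.*2).-1 * t%:Z) s%:Z != 0 ->
  (G <= 2 ^ (12 * h.+1) * Y ^ (4 * h.+1) * a ^ h.+1)%N.
  move=> eH hH ehH V0; have := padeV_le eH hH ehH y0 a0 Et xY yY xc.
  rewrite Es; set V := padeV _ _ _ _ _ _ in V0 *.
  rewrite -abszE lez_nat; apply: leq_trans; apply: dvdn_leq.
    by rewrite absz_gt0.
  change (G%:Z %| V)%Z; rewrite rpredB //.
    by rewrite dvdz_mulr // ehH dvdzE abszX.
  by rewrite dvdz_mulr // dvdz_mull.
have s0' : s%:Z != 0 by rewrite eqz_nat -lt0n.
case/orP: (padeV_neq0 h h (y ^+ (h.+1.*2).-1 * t%:Z) x0 c0 s0'); apply: key; lia.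
Qed.

(** * Common divisors of two solutions *)

Lemma expn_1D (t r : nat) : exists q, ((1 + t) ^ r = 1 + r * t + t ^ 2 * q)%N.
Proof.
elim: r => [|r [q IHr]]; first by exists 0%N; rewrite muln0.
by exists (r + q + t * q)%N; rewrite expnS IHr; ring.
Qed.

(** Lifting the exponent: [p] divides [a - 1] exactly once, hence [a ^ (p ^ k) - 1] exactly [k.+1]
    times. The expansion of the [p]-th power is a hypothesis, which [ring] can check for [p = 3] and
    [p = 5]. *)
Lemma dvdn_exp_sub1 (p a u : nat) : prime p ->
  (forall t w, exists v, ((1 + p * t * w) ^ p = 1 + p * p * t * (w + p * v))%N) ->
  a = (1 + p * u)%N -> ~~ (p %| u)%N ->
  forall k N, (p ^ k.+1 %| a ^ N - 1)%N -> (p ^ k %| N)%N.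
Proof.
move=> pp Hp -> pu.
have pow k : exists2 w, ~~ (p %| w)%N & ((1 + p * u) ^ (p ^ k) = 1 + p ^ k.+1 * w)%N.
  elim: k => [|k [w pw IHk]]; first by exists u.
  have [v Hv] := Hp (p ^ k)%N w; exists (w + p * v)%N.
    by rewrite dvdn_addl // dvdn_mulr.
  by rewrite expnSr expnM IHk [(p ^ k.+1)%N]expnS Hv !expnS !mulnA.
elim=> [|k IHk] N hN; first by rewrite dvd1n.
have /dvdnP[r Nr] : (p ^ k %| N)%N.
  by apply: IHk; apply: dvdn_trans hN; rewrite dvdn_exp2l.
have [w pw Hw] := pow k.
have p0 : (0 < p)%N := prime_gt0 pp.
move: hN; rewrite Nr (mulnC r) expnM Hw.
have [q ->] := expn_1D (p ^ k.+1 * w) r.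
rewrite -addnA addKn dvdn_addl; last first.
  by rewrite dvdn_mulr // expnMn dvdn_mulr // -expnM dvdn_exp2l //; lia.
rewrite mulnCA expnSr dvdn_pmul2l ?expn_gt0 ?p0 // Euclid_dvdM // (negbTE pw) orbF.
by move=> pr; rewrite expnSr dvdn_mul.
Qed.

(** The order of 2 modulo 3 is 2, so [N] is even and lifting applies to [4 = 1 + 3 * 1]. *)
Lemma dvdn3_exp2_sub1 k N : (3 ^ k.+1 %| 2 ^ N - 1)%N -> (3 ^ k %| N)%N.
Proof.
move=> h; have h3 : (3 %| 2 ^ N - 1)%N.
  by apply: dvdn_trans h; rewrite expnS dvdn_mulr.
have [q E] : exists q, N = (2 * q)%N.
  have /eqP r0 : (N %% 2 == 0)%N.
    move: h3 (ltn_pmod N (isT : 0 < 2)%N); rewrite {1}(divn_eq N 2).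
    move: (N %/ 2)%N (N %% 2)%N => q r; rewrite expnD mulnC (mulnC q) expnM.
    rewrite -eqn_mod_dvd ?muln_gt0 ?expn_gt0 // -modnMmr -modnXm exp1n.
    by case: r => [|[|]].
  by exists (N %/ 2)%N; rewrite {1}(divn_eq N 2) r0 addn0 mulnC.
rewrite E dvdn_mull //.
apply: (@dvdn_exp_sub1 3 4 1) => //.
  by move=> t w; exists (t * w ^ 2 + t ^ 2 * w ^ 3)%N; ring.
by move: h; rewrite E expnM.
Qed.

(** The order of 2 modulo 5 is 4, so lifting applies to [16 = 1 + 5 * 3]. *)
Lemma dvdn5_exp2_sub1 k N : (5 ^ k.+1 %| 2 ^ N - 1)%N -> (5 ^ k %| N)%N.
Proof.
move=> h; have h5 : (5 %| 2 ^ N - 1)%N.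
  by apply: dvdn_trans h; rewrite expnS dvdn_mulr.
have [q E] : exists q, N = (4 * q)%N.
  have /eqP r0 : (N %% 4 == 0)%N.
    move: h5 (ltn_pmod N (isT : 0 < 4)%N); rewrite {1}(divn_eq N 4).
    move: (N %/ 4)%N (N %% 4)%N => q r; rewrite expnD mulnC (mulnC q) expnM.
    rewrite -eqn_mod_dvd ?muln_gt0 ?expn_gt0 // -modnMmr -modnXm exp1n.
    by case: r => [|[|[|[|]]]].
  by exists (N %/ 4)%N; rewrite {1}(divn_eq N 4) r0 addn0 mulnC.
rewrite E dvdn_mull //.
apply: (@dvdn_exp_sub1 5 16 3) => //.
  move=> t w; exists (2 * t * w ^ 2 + 10 * t ^ 2 * w ^ 3
    + 25 * t ^ 3 * w ^ 4 + 25 * t ^ 4 * w ^ 5)%N; ring.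
by move: h; rewrite E expnM.
Qed.

(** Two liftings: for [i >= 2], [p^(i-1)] divides [2^m * (2^d - 1)], hence [2^d - 1] as [p] is odd,
    and then [p^(i-2)] divides [d]. *)
Lemma expn_dvd_le (p i m d : nat) : coprime p 2 -> (0 < d)%N -> (0 < p)%N ->
  (forall k N, p ^ k.+1 %| 2 ^ N - 1 -> p ^ k %| N)%N ->
  (p ^ i %| 2 ^ (2 ^ m * (2 ^ d - 1)) - 1)%N -> (p ^ i <= p ^ 2 * d)%N.
Proof.
move=> cp d0 p0 lte; case: i => [|[|i]].
- by rewrite muln_gt0 expn_gt0 p0 d0.
- by move=> _; rewrite expn1 -mulnA leq_pmulr // muln_gt0 p0.
move=> /lte; rewrite Gauss_dvdr ?coprimeXl ?coprimeXr // => /lte /dvdn_leq h.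
by rewrite -addn2 addnC expnD leq_mul2l h ?orbT.
Qed.

(** [t - s = y * 2^(2^m) * (2^(2^m * (2^d - 1)) - 1)], and [D] is coprime to the first two factors:
    a common divisor of [D] and [y] divides [x]. *)
Lemma dvdn_common (x y : int) (D m d s t : nat) : coprimez x y -> odd D ->
  y * (2 ^ (2 ^ m))%N%:Z - x = s%:Z -> y * (2 ^ (2 ^ (m + d)))%N%:Z - x = t%:Z ->
  (D %| s)%N -> (D %| t)%N -> (D %| 2 ^ (2 ^ m * (2 ^ d - 1)) - 1)%N.
Proof.
move=> cxy oD Es Et Ds Dt.
have cDy : coprimez D y.
  rewrite /coprimez; apply/eqP.
  have h1 : (gcdz D y %| x)%Z.
    have -> : x = y * (2 ^ (2 ^ m))%N%:Z - s%:Z by rewrite -Es; ring.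
    rewrite rpredB ?dvdz_mulr ?dvdz_gcdr //.
    by apply: dvdz_trans (dvdz_gcdl _ _) _.
  have : (gcdz D y %| gcdz x y)%Z by rewrite dvdz_gcd h1 dvdz_gcdr.
  by move/eqP: cxy => ->; rewrite dvdz1 /gcdz absz_nat => /eqP ->.
have : (D %| y * ((2 ^ (2 ^ m))%N%:Z * (2 ^ (2 ^ m * (2 ^ d - 1)) - 1)%N%:Z))%Z.
  have -> : y * ((2 ^ (2 ^ m))%N%:Z * (2 ^ (2 ^ m * (2 ^ d - 1)) - 1)%N%:Z)
      = t%:Z - s%:Z.
    rewrite -Es -Et -PoszM mulnBr muln1 -expnD.
    have -> : (2 ^ m + 2 ^ m * (2 ^ d - 1) = 2 ^ (m + d))%N.
      by rewrite mulnBr muln1 subnKC ?expnD // leq_pmulr ?expn_gt0.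
    by rewrite -subzn ?leq_pexp2l ?leq_addr //; ring.
  by rewrite rpredB.
rewrite Gauss_dvdzr // Gauss_dvdzr //.
by rewrite /coprimez /gcdz /= eqz_nat -/(coprime _ _) coprimeXr // coprimen2.
Qed.

(** For powers [A], [A'] of 3 and [B], [B'] of 5, the right side is a cubed gcd. In the lopsided
    cases the smaller dominant factor suffices, as [(A * B)^2 <= A^3] or symmetrically. In the
    balanced case, a gcd [A * B'] mixing both numbers satisfies [A * B * A' * B' <= (A * B')^3]. *)
Lemma same_class_le (A B A' B' : nat) :
  (0 < A)%N -> (0 < B)%N -> (0 < A')%N -> (0 < B')%N ->
  [\/ (B ^ 2 <= A)%N /\ (B' ^ 2 <= A')%N, (A ^ 2 <= B)%N /\ (A' ^ 2 <= B')%N |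
     [/\ A <= B ^ 2, B <= A ^ 2, A' <= B' ^ 2 & B' <= A' ^ 2]%N] ->
  (minn (A * B) (A' * B') ^ 2 <= (minn A A' * minn B B') ^ 3)%N.
Proof.
have lopsided a b a' b' : (0 < b)%N -> (0 < b')%N -> (b ^ 2 <= a)%N ->
    (b' ^ 2 <= a')%N ->
    (minn (a * b) (a' * b') ^ 2 <= (minn a a' * minn b b') ^ 3)%N.
  have one c d m : (0 < m)%N -> (d ^ 2 <= c)%N -> ((c * d) ^ 2 <= (c * m) ^ 3)%N.
    move=> m0 dc; apply: (@leq_trans (c ^ 3)).
      by rewrite expnMn (expnSr c 2) leq_mul2l dc orbT.
    by rewrite leq_exp2r // leq_pmulr.
  move=> b0 b0' ba ba'; have m0 : (0 < minn b b')%N by rewrite leq_min b0.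
  case: (leqP a a') => _; apply: leq_trans (one _ _ _ m0 _).
  - by rewrite leq_sqr; apply: geq_minl.
  - by [].
  - by rewrite leq_sqr; apply: geq_minr.
  - by [].
have mixed a b a' b' : (b <= a ^ 2)%N -> (a' <= b' ^ 2)%N ->
    (minn (a * b) (a' * b') ^ 2 <= (a * b') ^ 3)%N.
  move=> ba ab'; apply: (@leq_trans ((a * b) * (a' * b'))).
    by rewrite -mulnn leq_mul ?geq_minl ?geq_minr.
  by rewrite expnMn (expnS a) (expnSr b') !leq_mul.
have balanced a b a' b' : (0 < a)%N -> (0 < b)%N -> 
    (minn (a * b) (a' * b') ^ 2 <= (a * b) ^ 3)%N.
  move=> a0 b0; apply: (@leq_trans ((a * b) ^ 2)).
    by rewrite leq_sqr geq_minl.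
  by rewrite leq_pexp2l // muln_gt0 a0.
move=> A0 B0 A0' B0' [[h1 h2]|[h1 h2]|[h1 h2 h3 h4]].
- exact: lopsided.
- by have := lopsided B A B' A'; rewrite ![(B * _)%N]mulnC ![(B' * _)%N]mulnC
    ![(minn B B' * _)%N]mulnC; apply.
- case: (leqP A A') => _; case: (leqP B B') => _.
  + exact: balanced.
  + exact: mixed.
  + by rewrite minnC; apply: mixed.
  + by rewrite minnC; apply: balanced.
Qed.

Definition size_class (i j : nat) : nat :=
  if ((5 ^ j) ^ 2 <= 3 ^ i)%N then 0 else if ((3 ^ i) ^ 2 <= 5 ^ j)%N then 1 else 2.

(** The inequalities defining a class survive [K]-th powers, so [same_class_le] applies to the
    [K]-th power of the first number. *)
Lemma size_class_gcd K i j i' j' : size_class i j = size_class i' j' ->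
  (minn ((3 ^ i * 5 ^ j) ^ K) (3 ^ i' * 5 ^ j') ^ 2
   <= (3 ^ minn (K * i) i' * 5 ^ minn (K * j) j') ^ 3)%N.
Proof.
move=> hc.
have expn_min p a b : (1 < p)%N -> (p ^ minn a b = minn (p ^ a) (p ^ b))%N.
  move=> p1; case: (leqP a b) => ab.
    by rewrite (minn_idPl _) // leq_exp2l.
  by rewrite (minn_idPr _) // leq_exp2l // ltnW.
rewrite !expn_min // expnMn -!expnM (mulnC i) (mulnC j).
have mono k m n : (m <= n)%N -> (m ^ k <= n ^ k)%N.
  by case: k => // k mn; rewrite leq_exp2r.
have up p q a b : ((p ^ a) ^ 2 <= q ^ b)%N -> ((p ^ (K * a)) ^ 2 <= q ^ (K * b))%N.
  by move/(mono K); rewrite -!expnM -!mulnA !(mulnC K) !mulnA.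
have up' p q a b : (q ^ b <= (p ^ a) ^ 2)%N -> (q ^ (K * b) <= (p ^ (K * a)) ^ 2)%N.
  by move/(mono K); rewrite -!expnM -!mulnA !(mulnC K) !mulnA.
apply: same_class_le; rewrite ?expn_gt0 //; move: hc; rewrite /size_class.
case: (leqP ((5 ^ j) ^ 2) (3 ^ i)) => h1; case: (leqP ((5 ^ j') ^ 2) (3 ^ i')) => h2.
- by move=> _; constructor 1; split => //; apply: up.
- by case: ifP.
- by case: ifP.
case: (leqP ((3 ^ i) ^ 2) (5 ^ j)) => h3; case: (leqP ((3 ^ i') ^ 2) (5 ^ j')) => h4 // _.
  by constructor 2; split => //; apply: up.
by constructor 3; split; try apply: up'; apply: ltnW.
Qed.

Definition sol (x y : int) (n i j : nat) : Prop :=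
  y * (2 ^ 2 ^ n)%N%:Z - x = (3 ^ i * 5 ^ j)%N%:Z.

(** The 3-part and the 5-part of the gcd are at most [3^2 * (n - m)] and [5^2 * (n - m)]. *)
Lemma sol_common_le x y m n i j i' j' : coprimez x y -> (m < n)%N ->
  sol x y m i j -> sol x y n i' j' ->
  (3 ^ minn i i' * 5 ^ minn j j' <= 225 * (n - m) ^ 2)%N.
Proof.
move=> cxy mn Es Et; have d0 : (0 < n - m)%N by rewrite subn_gt0.
have -> : (225 * (n - m) ^ 2 = (3 ^ 2 * (n - m)) * (5 ^ 2 * (n - m)))%N by ring.
rewrite /sol -(subnKC (ltnW mn)) in Et.
apply: leq_mul.
  apply: (@expn_dvd_le _ _ m _ _ d0) => //; first exact: dvdn3_exp2_sub1.
  apply: (dvdn_common cxy _ Es Et); first by rewrite oddX orbT.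
    by rewrite dvdn_mulr // dvdn_exp2l // geq_minl.
  by rewrite dvdn_mulr // dvdn_exp2l // geq_minr.
apply: (@expn_dvd_le _ _ m _ _ d0) => //; first exact: dvdn5_exp2_sub1.
apply: (dvdn_common cxy _ Es Et); first by rewrite oddX orbT.
  by rewrite dvdn_mull // dvdn_exp2l // geq_minl.
by rewrite dvdn_mull // dvdn_exp2l // geq_minr.
Qed.

Lemma sol_gap x y m n i j i' j' : coprimez x y -> (m < n)%N ->
  sol x y m i j -> sol x y n i' j' -> size_class i j = size_class i' j' ->
  (minn (3 ^ i * 5 ^ j) (3 ^ i' * 5 ^ j') ^ 2 <= (225 * (n - m) ^ 2) ^ 3)%N.
Proof.
move=> cxy mn Es Et hc; have := size_class_gcd 1 hc.
rewrite expn1 !mul1n => /leq_trans; apply.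
by rewrite leq_exp2r // (sol_common_le cxy mn Es Et).
Qed.

Lemma sol_sub x y m n i j i' j' : sol x y m i j -> sol x y n i' j' ->
  (3 ^ i' * 5 ^ j')%N%:Z = (3 ^ i * 5 ^ j)%N%:Z
    + y * ((2 ^ 2 ^ n)%N%:Z - (2 ^ 2 ^ m)%N%:Z).
Proof. by rewrite /sol => <- <-; ring. Qed.

Lemma double_exp2_le m n : (m < n)%N -> (2 * 2 ^ 2 ^ m <= 2 ^ 2 ^ n)%N.
Proof.
move=> mn; rewrite -expnS leq_exp2l // (leq_trans _ (_ : 2 ^ m.+1 <= _)%N) //.
  by rewrite expnS mul2n -addnn -addn1 addnC leq_add2r expn_gt0.
by rewrite leq_exp2l.
Qed.

Lemma lin_lt_exp2 a b c n :
  (c <= n)%N -> (a <= 2 ^ c)%N -> (a * c + b < 2 ^ c)%N ->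
  (a * n + b < 2 ^ n)%N.
Proof.
move=> cn ac hc; rewrite -(subnKC cn); elim: (n - c)%N => [|k IHk].
  by rewrite addn0.
have ak : (a <= 2 ^ (c + k))%N by rewrite (leq_trans ac) // leq_exp2l // leq_addr.
rewrite addnS expnS mul2n -addnn mulnS -addnA.
by apply: leq_ltn_trans (leq_add ak (leqnn _)) _; rewrite ltn_add2l.
Qed.

(** For [y < 0] the values decrease with the index and stay positive, so the value at [n] is below
    that at [m] and at least half of [2^(2^M)]. This exceeds the bound of [sol_gap], which is
    polynomial in [M]. *)
Lemma no_neg_sol x y m n M i j i' j' i'' j'' : coprimez x y -> y < 0 ->
  (m < n)%N -> (n < M)%N -> (7 <= M)%N ->
  sol x y m i j -> sol x y n i' j' -> sol x y M i'' j'' ->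
  size_class i j = size_class i' j' -> False.
Proof.
move=> cxy y0 mn nM M7 Em En EM hc.
have := sol_gap cxy mn Em En hc.
have : (3 ^ i' * 5 ^ j' <= 3 ^ i * 5 ^ j)%N.
  rewrite -lez_nat (sol_sub Em En).
  have := double_exp2_le mn; rewrite -lez_nat PoszM.
  by move: (3 ^ i * 5 ^ j)%N (2 ^ 2 ^ m)%N (2 ^ 2 ^ n)%N => s a b; nia.
move/minn_idPr => ->.
have h2 : (2 ^ 2 ^ M <= 2 * (3 ^ i' * 5 ^ j'))%N.
  have := sol_sub En EM; have := double_exp2_le nM.
  move: (3 ^ i' * 5 ^ j')%N (3 ^ i'' * 5 ^ j'')%N (2 ^ 2 ^ n)%N (2 ^ 2 ^ M)%N => s t a b.
  by rewrite -!lez_nat !PoszM; nia.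
move=> h1.
have h3 : (225 * (n - m) ^ 2 <= 2 ^ (2 * M + 8))%N.
  rewrite addnC expnD leq_mul // mulnC expnM leq_sqr.
  by rewrite (leq_trans _ (ltnW (ltn_expl M (ltnSn 1)))) //; lia.
have h4 : ((2 ^ 2 ^ M) ^ 2 <= 2 ^ 2 * (2 ^ (2 * M + 8)) ^ 3)%N.
  apply: (@leq_trans ((2 * (3 ^ i' * 5 ^ j')) ^ 2)%N); first by rewrite leq_sqr.
  by rewrite expnMn leq_mul // (leq_trans h1) // leq_exp2r.
move: h4; rewrite -!expnM -expnD leq_exp2l //; apply/negP; rewrite -ltnNge.
(* The exponents of 2 to compare are [6 * M + 26] and [2 * 2 ^ M]. *)
have := @lin_lt_exp2 6 26 7 M M7 isT isT.
by move: (2 ^ M)%N => z; lia.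
Qed.

(** * Solutions in one class *)

Lemma sqr_le_exp2 m : (4 <= m)%N -> (m ^ 2 <= 2 ^ m)%N.
Proof.
move=> m4; rewrite -(subnKC m4); elim: (m - 4)%N => [|d IHd] //.
rewrite addnS (expnS 2); apply: leq_trans (leq_mul (leqnn 2) IHd).
by clear; rewrite -!mulnn; nia.
Qed.

(** After cancelling [a^(3h)] an [h]-th root is taken, with [40 = 2 * 2 + 12 * 3] and
    [12 = 4 * 3]. *)
Lemma root_le a Y h : (0 < h)%N -> (0 < a)%N ->
  ((a ^ h.*2) ^ 2
    <= (2 ^ h.*2) ^ 2 * (2 ^ (12 * h) * Y ^ (4 * h) * a ^ h) ^ 3)%N ->
  (a <= 2 ^ 40 * Y ^ 12)%N.
Proof.
move=> h0 a0 H.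
have : (a ^ h * (a ^ h) ^ 3 <= (2 ^ 40 * Y ^ 12) ^ h * (a ^ h) ^ 3)%N.
  have -> : (a ^ h * (a ^ h) ^ 3 = (a ^ h.*2) ^ 2)%N.
    by rewrite -expnS -!expnM; congr (_ ^ _)%N; clear; lia.
  apply: leq_trans H _; rewrite (expnMn (2 ^ 40)) -(expnM 2 40) -(expnM Y 12).
  rewrite (expnMn (_ * _)) (expnMn (2 ^ (12 * h))) -(expnM 2 h.*2) -(expnM 2 (12 * h)).
  rewrite -(expnM Y (4 * h)) !mulnA -expnD.
  have -> : (h.*2 * 2 + 12 * h * 3 = 40 * h)%N by clear; lia.
  by have -> : (4 * h * 3 = 12 * h)%N by clear; lia.
by rewrite leq_pmul2r ?expn_gt0 ?a0 // leq_exp2r.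
Qed.

(** The indices [k] and [l] make the value [Y] at [l] a bound for [y] and [|x|]; [l] and [m] bound
    [Y] polynomially in [m] by [sol_gap]; [m] and [n] enter [pade_gap], which would force
    [a <= 2^40 * Y^12]. *)
Lemma no_pos_sol x y k l m n ik jk il jl im jm i j :
  x != 0 -> coprimez x y -> 0 < y ->
  (k < l)%N -> (5 <= l)%N -> (l < m)%N -> (m < n)%N ->
  sol x y k ik jk -> sol x y l il jl -> sol x y m im jm -> sol x y n i j ->
  size_class il jl = size_class im jm -> size_class im jm = size_class i j ->
  False.
Proof.
move=> x0 cxy y0 kl l5 lm mn Ek El Em En hlm hmn.
have gap_lm := sol_gap cxy lm El Em hlm.
pose Y := (3 ^ il * 5 ^ jl)%N.
pose s := (3 ^ im * 5 ^ jm)%N.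
pose t := (3 ^ i * 5 ^ j)%N.
pose a := (2 ^ 2 ^ m)%N.
have dle p q : (p < q)%N -> 2 * (2 ^ 2 ^ p)%N%:Z <= (2 ^ 2 ^ q)%N%:Z.
  by move=> pq; rewrite -PoszM lez_nat double_exp2_le.
have pos p : 0 < (2 ^ 2 ^ p)%N%:Z by rewrite ltz_nat expn_gt0.
have Yy : y <= Y%:Z.
  have := sol_sub Ek El; have := dle _ _ kl; have := pos k.
  by rewrite -/Y; move: (Y) (3 ^ ik * 5 ^ jk)%N => u v; nia.
have Yal : y * (2 ^ 2 ^ l)%N%:Z <= 2 * Y%:Z.
  have := sol_sub Ek El; have := dle _ _ kl; have := pos k.
  by rewrite -/Y; move: (Y) (3 ^ ik * 5 ^ jk)%N => u v; nia.
(* [x = y * 2^(2^l) - Y], where the product lies between 0 and [2 * Y]. *)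
have xY : `|x| <= Y%:Z.
  have := pos l; move: El Yal; rewrite /sol -/Y ler_norml.
  by move: (2 ^ 2 ^ l)%N => b; nia.
have Ys : (Y <= s)%N.
  rewrite -lez_nat (sol_sub El Em) -/Y; have := dle _ _ lm; have := pos l.
  by move: (2 ^ 2 ^ l)%N (2 ^ 2 ^ m)%N => b c; nia.
have s2 : (a <= 2 * s)%N.
  rewrite -lez_nat PoszM (sol_sub El Em) -/Y -/a; have := dle _ _ lm.
  by move: (2 ^ 2 ^ l)%N => b; rewrite -/a; nia.
have t2 : (2 ^ 2 ^ n <= 2 * t)%N.
  rewrite -lez_nat PoszM (sol_sub El En) -/Y; have := dle _ _ (ltn_trans lm mn).
  by move: (2 ^ 2 ^ l)%N (2 ^ 2 ^ n)%N => b c; nia.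
have Y2 : (Y ^ 2 <= (225 * m ^ 2) ^ 3)%N.
  move: gap_lm; rewrite -/Y -/s (minn_idPl Ys) => /leq_trans; apply.
  by rewrite leq_exp2r // leq_mul2l leq_sqr leq_subr orbT.
(* From 9 on, [18 * m + 184 < 2^m], as [big] requires. For [m <= 8], [l >= 5] gives [2^32 <= 2 * Y],
   against [Y^2 <= (225 * 8^2)^3 <= 2^42]. *)
have m9 : (9 <= m)%N.
  rewrite leqNgt; apply/negP => m8.
  have h1 : (2 ^ 2 ^ 5 <= 2 * Y)%N.
    rewrite (@leq_trans (2 ^ 2 ^ l)%N) //; first by rewrite !leq_exp2l.
    rewrite -lez_nat PoszM; apply: le_trans Yal.
    by rewrite -[leLHS]mul1r ler_wpM2r.
  have h2 : ((2 ^ 2 ^ 5) ^ 2 <= 2 ^ 2 * (2 ^ 14) ^ 3)%N.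
    apply: (@leq_trans ((2 * Y) ^ 2)%N); first by rewrite leq_sqr.
    rewrite expnMn leq_mul2l (leq_trans Y2) ?orbT // leq_exp2r //.
    by apply: (@leq_trans (225 * 8 ^ 2)%N) => //; rewrite leq_mul2l leq_sqr; lia.
  by move: h2; rewrite -!expnM -expnD leq_exp2l.
have big : (2 ^ 40 * Y ^ 12 < a)%N.
  have m2 := sqr_le_exp2 (leq_trans (isT : 4 <= 9)%N m9).
  (* [Y^12] is at most [(225 * m^2)^18], where [225 <= 2^8] and [m^2 <= 2^m]. *)
  have h1 : (Y ^ 12 <= 2 ^ (18 * m + 144))%N.
    have -> : (Y ^ 12 = (Y ^ 2) ^ 6)%N by rewrite -expnM.
    apply: (@leq_trans (((225 * m ^ 2) ^ 3) ^ 6)%N); first by rewrite leq_exp2r.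
    rewrite -expnM; apply: (@leq_trans ((2 ^ 8 * 2 ^ m) ^ (3 * 6))%N).
      by rewrite leq_exp2r // leq_mul.
    by rewrite -expnD -expnM leq_exp2l //; lia.
  apply: (@leq_ltn_trans (2 ^ 40 * 2 ^ (18 * m + 144))%N).
    by rewrite leq_mul2l h1 orbT.
  rewrite -expnD ltn_exp2l //; have := @lin_lt_exp2 18 184 9 m m9 isT isT.
  by move: (2 ^ m)%N => z; lia.
have Y0 : (0 < Y)%N by rewrite muln_gt0 !expn_gt0.
have Ya : (Y <= a)%N.
  apply: ltnW; apply: leq_ltn_trans big; rewrite -[leqLHS]mul1n.
  by rewrite leq_mul ?expn_gt0 // -{1}(expn1 Y) leq_pexp2l.
have [h H0 hE] : exists2 h, (0 < h)%N & (2 ^ (n - m) = h.*2)%N.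
  exists (2 ^ (n - m).-1)%N; first by rewrite expn_gt0.
  by rewrite -mul2n -expnS prednK // subn_gt0.
have aK : (2 ^ 2 ^ n = a ^ h.*2)%N.
  by rewrite -hE /a -expnM -expnD subnKC // ltnW.
(* The gcd of [s ^ h.*2] and [t]. *)
pose G := (3 ^ minn (h.*2 * im) i * 5 ^ minn (h.*2 * jm) j)%N.
have hG : (G <= 2 ^ (12 * h) * Y ^ (4 * h) * a ^ h)%N.
  apply: (@pade_gap x y a s t G Y h) => //.
  - by rewrite expn_gt0.
  - by rewrite muln_gt0 !expn_gt0.
  - by rewrite -aK.
  - rewrite (le_trans xY) // (@le_trans _ _ a%:Z) ?lez_nat //.
    by rewrite -[leLHS]mul1r ler_wpM2r.
  - rewrite /G /s expnMn -!expnM; apply: dvdn_mul; rewrite dvdn_exp2l // mulnC.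
      by rewrite mulnC geq_minl.
    by rewrite mulnC geq_minl.
  - by rewrite /G /t; apply: dvdn_mul; rewrite dvdn_exp2l // geq_minr.
have := size_class_gcd h.*2 hmn; rewrite -/s -/t -/G => hmin.
(* Here [a <= 2 * s] and [a ^ h.*2 <= 2 * t]. *)
have h1 : (a ^ h.*2 <= 2 ^ h.*2 * minn (s ^ h.*2) t)%N.
  rewrite minnMr leq_min -expnMn; apply/andP; split.
    by rewrite leq_exp2r // double_gt0.
  rewrite -aK (leq_trans t2) // leq_mul2r -{1}(expn1 2) leq_exp2l ?orbT //.
  by rewrite double_gt0 H0 orbT.
have h2 : ((a ^ h.*2) ^ 2
    <= (2 ^ h.*2) ^ 2 * (2 ^ (12 * h) * Y ^ (4 * h) * a ^ h) ^ 3)%N.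
  apply: (@leq_trans ((2 ^ h.*2 * minn (s ^ h.*2) t) ^ 2)%N).
    by rewrite leq_sqr.
  by rewrite expnMn leq_mul // (leq_trans hmin) // leq_exp2r.
have H : (a <= 2 ^ 40 * Y ^ 12)%N by apply: root_le H0 _ h2; rewrite expn_gt0.
by have := leq_ltn_trans H big; rewrite ltnn.
Qed.

(** * Counting *)

(** If the bound fails, then [n.+1] points inject into [A], whether [A] is finite or not, and their
    images form a list of distinct elements that is too long. *)
Lemma card_le_II_seq (T : pointedType) (A : set T) (n : nat) :
  (forall s : seq T, uniq s -> (forall t, t \in s -> A t) -> (size s <= n)%N) ->
  A #<= `I_n.
Proof.
move=> hA; apply: contrapT => hn.
have /pcard_leP/injfunPex[f fA fI] : `I_n.+1 #<= A.
  have [[m Am]|/infiniteP inf] := pselect (finite_set A).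
    rewrite (card_le_eqr Am) card_le_II ltnNge; apply/negP => mn; apply: hn.
    by rewrite (card_le_eql Am) card_le_II.
  by apply: card_le_trans inf; apply: subset_card_le.
have := hA (map f (iota 0 n.+1)); rewrite size_map size_iota ltnn => H.
suff : false by []; apply: H.
  rewrite map_inj_in_uniq ?iota_uniq // => i j.
  by rewrite !mem_iota /= !add0n => hi hj; apply: fI; rewrite inE.
by move=> t /mapP[i]; rewrite mem_iota /= => hi ->; apply: fA.
Qed.

Lemma dvdn_expM_prime p q w i j : prime p -> prime q ->
  (w %| p ^ i * q ^ j)%N -> exists i' j', w = (p ^ i' * q ^ j')%N.
Proof.
move=> pp pq hw.
have w0 : (0 < w)%N.
  by rewrite (dvdn_gt0 _ hw) // muln_gt0 !expn_gt0 !prime_gt0.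
have g0 : (0 < gcdn w (p ^ i))%N by rewrite gcdn_gt0 w0.
have gw := dvdn_gcdl w (p ^ i); have gp := dvdn_gcdr w (p ^ i).
have cw : coprime (w %/ gcdn w (p ^ i)) (p ^ i %/ gcdn w (p ^ i)).
  by rewrite /coprime -(eqn_pmul2r g0) muln_gcdl mul1n !divnK.
have /(dvdn_pfactor _ _ pp)[i' _ Ei] := gp.
have /(dvdn_pfactor _ _ pq)[j' _ Ej] : (w %/ gcdn w (p ^ i) %| q ^ j)%N.
  by rewrite -(Gauss_dvdr _ cw) -(dvdn_pmul2r g0) mulnAC !divnK.
by exists i', j'; rewrite -Ei -Ej mulnC divnK.
Qed.

(** Six increasing indices from 2 on have [u 3 >= 5] and [u 5 >= 7], as [no_pos_sol] and
    [no_neg_sol] require. *)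
Lemma sol_class_size x y c (ns : seq nat) : x != 0 -> y != 0 -> coprimez x y ->
  sorted ltn ns ->
  (forall n, n \in ns ->
     (2 <= n)%N /\ exists i j, sol x y n i j /\ size_class i j = c) ->
  (size ns <= 5)%N.
Proof.
move=> x0 y0 cxy ns_sorted hns; rewrite leqNgt; apply/negP => s6.
pose u := nth 0%N ns.
have uS k : (k < 5)%N -> (u k < u k.+1)%N.
  move=> k5; apply: (sorted_ltn_nth ltn_trans 0%N ns_sorted) => //.
    by rewrite inE (leq_trans _ s6) // ltnS ltnW.
  by rewrite inE (leq_trans _ s6).
have hu k : (k < 6)%N ->
    (2 <= u k)%N /\ exists i j, sol x y (u k) i j /\ size_class i j = c.
  by move=> k6; apply: hns; rewrite mem_nth // (leq_trans k6).
have [u0 [i0 [j0 [E0 C0]]]] := hu 0%N isT.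
have [_ [i1 [j1 [E1 C1]]]] := hu 1%N isT.
have [_ [i2 [j2 [E2 C2]]]] := hu 2%N isT.
have [_ [i3 [j3 [E3 C3]]]] := hu 3%N isT.
have [_ [i4 [j4 [E4 C4]]]] := hu 4%N isT.
have [_ [i5 [j5 [E5 C5]]]] := hu 5%N isT.
have := (uS 0 isT, uS 1 isT, uS 2 isT, uS 3 isT, uS 4 isT)%N => -[[[[u1 u2] u3] u4] u5].
case: (ltgtP y 0) y0 => // hy _.
  by apply: (@no_neg_sol x y _ _ _ _ _ _ _ _ _ cxy hy u1 _ _ E0 E1 E5);
    rewrite ?C0 ?C1 //; lia.
apply: (@no_pos_sol x y _ _ _ _ _ _ _ _ _ _ _ _ x0 cxy hy u3 _ u4 u5 E2 E3 E4 E5);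
  by rewrite ?C3 ?C4 ?C5 //; lia.
Qed.

Lemma sol_size x y (T : seq (nat * nat * nat)) :
  x != 0 -> y != 0 -> coprimez x y ->
  uniq [seq t.1.1 | t <- T] ->
  (forall t, t \in T -> sol x y t.1.1 t.1.2 t.2) -> (size T <= 17)%N.
Proof.
move=> x0 y0 cxy uT hT.
pose cl c (t : nat * nat * nat) := (2 <= t.1.1)%N && (size_class t.1.2 t.2 == c).
have hcl c : (count (cl c) T <= 5)%N.
  rewrite -size_filter -(size_map (fun t => t.1.1)) -(size_sort leq).
  apply: (@sol_class_size x y c) => //.
    rewrite ltn_sorted_uniq_leq sort_uniq sort_sorted ?andbT; last exact: leq_total.
    by apply: subseq_uniq uT; apply: map_subseq; apply: filter_subseq.
  move=> n; rewrite mem_sort => /mapP[t].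
  rewrite mem_filter => /andP[/andP[h1 /eqP h2] h3 ->].
  by split => //; exists t.1.2, t.2; split => //; apply: hT.
have hlow : (count (fun t : nat * nat * nat => t.1.1 < 2) T <= 2)%N.
  rewrite -size_filter -(size_map (fun t => t.1.1)) -(size_iota 0 2).
  apply: uniq_leq_size.
    by apply: subseq_uniq uT; apply: map_subseq; apply: filter_subseq.
  by move=> n /mapP[t]; rewrite mem_filter mem_iota => /andP[h _] ->.
have : (size T <= count (fun t : nat * nat * nat => t.1.1 < 2) T + count (cl 0) T
    + count (cl 1) T + count (cl 2) T)%N.
  elim: (T) => //= t T' IH.
  have : (1 <= (t.1.1 < 2) + cl 0 t + cl 1 t + cl 2 t)%N.
    rewrite /cl /size_class; case: (ltnP t.1.1 2) => //= _.
    by case: ifP => // _; case: ifP.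
  lia.
have := (hcl 0, hcl 1, hcl 2)%N => -[[h0 h1] h2]; lia.
Qed.

(** Dividing by the gcd may change the exponents but not the index: a positive divisor of
    [3^i * 5^j] again has this form. *)
Lemma sol_reduce (x y : int) : y != 0 -> exists x' y',
  [/\ coprimez x' y', (x != 0 -> x' != 0), y' != 0 &
   forall n i j, sol x y n i j -> exists i' j', sol x' y' n i' j'].
Proof.
move=> y0; have g0 : gcdz x y != 0 by rewrite gcdz_eq0 negb_and y0 orbT.
have Ex := divzK (dvdz_gcdl x y); have Ey := divzK (dvdz_gcdr x y).
have gp : 0 < gcdz x y by rewrite lt0r g0.
set g := gcdz x y in Ex Ey g0 gp *.
exists (x %/ g)%Z, (y %/ g)%Z; split.
- rewrite /coprimez -(inj_eq (mulIf g0)) mul1r.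
  by rewrite -[X in _ * X == _](gtz0_abs gp) mulz_gcdl Ex Ey.
- by rewrite -{1}Ex mulf_eq0 negb_or => /andP[].
- by move: y0; rewrite -{1}Ey mulf_eq0 negb_or => /andP[].
move=> n i j; rewrite /sol -{1}Ex -{1}Ey.
rewrite mulrAC -mulrBl; set w := _ - _ => E.
have w0 : 0 < w by rewrite -(pmulr_lgt0 _ gp) E ltz_nat muln_gt0 !expn_gt0.
have [i' [j' Ew]] : exists i' j', `|w|%N = (3 ^ i' * 5 ^ j')%N.
  apply: (@dvdn_expM_prime 3 5 _ i j) => //.
  by have := congr1 absz E; rewrite abszM absz_nat => <-; rewrite dvdn_mulr.
by exists i', j'; rewrite -Ew gtz0_abs.
Qed.

Theorem theorem8p8 (x y : int) (hx : x <> 0) (hy : y <> 0) :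
  [set t : nat * nat * nat |
    let: (n, i, j) := t in
    y * 2 ^+ (2 ^ n)%N - x = 3 ^+ i * 5 ^+ j]%classic #<= `I_17.
Proof.
have x0 : x != 0 by apply/eqP.
have y0 : y != 0 by apply/eqP.
have solP n i j : y * 2 ^+ (2 ^ n)%N - x = 3 ^+ i * 5 ^+ j -> sol x y n i j.
  by rewrite /sol PoszM !PoszX.
have [x' [y' [cxy /(_ x0) x0' y0' red]]] := sol_reduce x y0.
apply: card_le_II_seq => s us hs.
pose Q (n : nat) (ij : nat * nat) := sol x' y' n ij.1 ij.2.
(* Exponents for the reduced equation are chosen per index; the default [(0, 0)] serves indices that
   do not occur in [s]. *)
have hQ n : exists ij, (exists t, t \in s /\ t.1.1 = n) -> Q n ij.
  have [[[[m i] j] [ts <-]]|no] := pselect (exists t, t \in s /\ t.1.1 = n); last first.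
    by exists (0%N, 0%N) => /no.
  have [i' [j' h]] := red _ _ _ (solP _ _ _ (hs _ ts)).
  by exists (i', j').
have [f hf] := choice hQ.
have := @sol_size x' y' [seq (t.1.1, (f t.1.1).1, (f t.1.1).2) | t <- s] x0' y0' cxy.
rewrite size_map; apply; last first.
  by move=> t /mapP[u us' ->] /=; apply: hf; exists u.
(* The index determines the value, and its valuations at 3 and 5 recover [i] and [j], so distinct
   triples have distinct indices. *)
rewrite -map_comp map_inj_in_uniq // => -[[n i] j] [[n' i'] j'] /hs /= h1 /hs /= h2 E.
rewrite -E in h2 *.
have := solP _ _ _ h1; rewrite /sol (solP _ _ _ h2) => -[E'].
have [ei ej] : i = i' /\ j = j'.
  have := congr1 (logn 3) E'; have := congr1 (logn 5) E'.
  rewrite !lognM ?expn_gt0 // !lognX !logn_prime //= !muln0 !muln1 addn0 add0n.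
  by rewrite !addn0 !add0n => -> ->.
by rewrite ei ej.
Qed.
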